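(* Let $\xi$ be a transcendental real number with $w_1(\xi)>3$. Then $$\widehat{w}_{2,sep}(\xi)\le 1+\frac{2}{w_1(\xi)-1}<2=\widehat{w}_2(\xi).$$ In particular, for any Liouville number $\xi$ we have $$\widehat{w}_{2,irr}(\xi)=\widehat{w}_{2,sep}(\xi)=1.$$
   Context: Let $n\ge 1$ be an integer and $\xi$ a transcendental real number. The height $H_P$ of a polynomial $P$ is the maximum modulus of its coefficients. For a real parameter $X>1$, let $$w(n,\xi,X)=-\frac{\log \min|P(\xi)|}{\log X},$$ where the minimum is over all non-zero integer polynomials $P$ of degree at most $n$ and height $H_P\le X$. Let $w_{sep}(n,\xi,X)$, respectively $w_{irr}(n,\xi,X)$, be defined in the same way, but with the minimum restricted to those polynomials $P$ that are separable (i.e. without multiple roots), respectively irreducible. Define $$w_n(\xi)=\limsup_{X\to\infty}w(n,\xi,X)\in[0,\infty],\qquad \widehat{w}_n(\xi)=\liminf_{X\to\infty}w(n,\xi,X),$$ $$\widehat{w}_{n,sep}(\xi)=\liminf_{X\to\infty}w_{sep}(n,\xi,X),\qquad \widehat{w}_{n,irr}(\xi)=\liminf_{X\to\infty}w_{irr}(n,\xi,X).$$ If $w_1(\xi)=\infty$, then $\frac{2}{w_1(\xi)-1}$ is read as $0$. A Liouville number is a transcendental real number $\xi$ with $w_1(\xi)=\infty$. *)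

(* Defs.v *)
From HB Require Import structures.
From mathcomp Require Import all_boot all_order all_algebra all_field.
From mathcomp Require Import all_classical all_reals all_analysis.

Set Implicit Arguments.
Unset Strict Implicit.
Unset Printing Implicit Defensive.

Import Order.TTheory GRing.Theory Num.Theory.
Import numFieldNormedType.Exports.

Local Open Scope classical_set_scope.
Local Open Scope ring_scope.

Definition transcendental (R : realType) (xi : R) : Prop :=
  ~ algebraicOver (@ratr R) xi.

Definition height (P : {poly int}) : nat := \max_(i < size P) absz (P`_i)%R.

Definition polyZQ (P : {poly int}) : {poly rat} := map_poly intr P.

Definition any_polys : set {poly int} := setT.

(* Nonzero constants have no roots, hence are separable. *)
Definition sep_polys : set {poly int} := [set P | separable_poly (polyZQ P)].

(* Irreducibility is over the rationals, so constants are excluded and the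
   content of P is irrelevant. *)
Definition irr_polys : set {poly int} := [set P | irreducible_poly (polyZQ P)].

Section Exponents.
Variable R : realType.
Implicit Types (K : set {poly int}) (n : nat) (xi X : R).

Definition eval_abs xi (P : {poly int}) : R := `|(map_poly intr P).[xi]|.

Definition admissible K n X : set {poly int} :=
  [set P | [/\ K P, P != 0, (size P <= n.+1)%N & (height P)%:R <= X]].

(* The infimum is a minimum: admissible K n X is finite, and it is nonempty
   as soon as 1 <= n, 1 <= X and K contains the polynomial 'X. *)
Definition min_value K n xi X : R := inf (eval_abs xi @` admissible K n X).

Definition w_at K n xi X : R := - ln (min_value K n xi X) / ln X.

Definition w_sup n xi : \bar R :=
  limf_esup (fun X => (w_at any_polys n xi X)%:E) (+oo : set_system R).

Definition w_hat K n xi : \bar R :=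
  limf_einf (fun X => (w_at K n xi X)%:E) (+oo : set_system R).

Definition liouville xi : Prop := transcendental xi /\ w_sup 1 xi = +oo%E.

End Exponents.

(* Main.v *)
Require Import Defs.
From HB Require Import structures.
From mathcomp Require Import all_boot all_order all_algebra all_field.
From mathcomp Require Import all_classical all_reals all_analysis.
From mathcomp Require Import zify ring lra.

Import Order.TTheory GRing.Theory Num.Theory.
Import numFieldNormedType.Exports.

Local Open Scope ereal_scope.

(** Why the theorem is true.

    Lower bounds come from Dirichlet's pigeonhole argument ([dirichlet]): for
    every N there is a nonzero integer polynomial of degree at most n and height
    at most N whose value at xi is O(N^-n).  In degree 2 this gives 2 for the
    unrestricted exponent; in degree 1 the polynomial is, for large N, genuinely
    linear, hence irreducible and separable, which gives 1 for the other two.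

    Upper bounds come from very good rational approximations.  If w < w_1(xi)
    there are coprime p and q, with q as large as desired, such that
    d = |q xi - p| <= q^-w ([good_rational_approximation]).  Expand an integer
    polynomial P of degree at most 2 and height at most X around p/q
    ([quadratic_taylor]).
    - If P(p/q) <> 0 then |P(p/q)| >= q^-2, so that |P(xi)| >= q^-2 / 2 as long
      as X is at most a small multiple of 1/(q d)
      ([nonroot_lower_bound]).
    - If P(p/q) = 0 then q divides the leading coefficient, so P'(p/q) is an
      integer.  When P is separable this integer is not 0, and |P(xi)| is at
      least about d/q ([simple_root_lower_bound]).
    With X of the order of 1/(q d), a separable P thus satisfies
    |P(xi)| >= d/(2q), and since d <= q^-w,
      log(2q/d) / log X <= (w + 1)/(w - 1) + o(1) = 1 + 2/(w - 1) + o(1),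
    where w may be taken arbitrarily close to w_1(xi).
    Without separability one takes X = q/2 instead: a polynomial of height less
    than q cannot vanish at p/q ([small_height_homogenized_neq0]), so only the
    first case occurs and |P(xi)| >= q^-2 / 2, which is X^-2 up to a constant.
    The condition X = O(1/(q d)) holds there because w_1(xi) > 3.

    For a Liouville number the upper bound for separable polynomials is 1; the
    argument only uses that the class of polynomials lies between the
    irreducible and the separable ones, so it covers both classes. *)

Set Implicit Arguments.
Unset Strict Implicit.

(** * Integer polynomials and their values *)

Section IntegerPolynomials.
Local Open Scope ring_scope.
Implicit Types (P : {poly int}).

Lemma height_coef P i : (absz (P`_i)%R <= height P)%N.
Proof.
have [ltiP|leiP] := ltnP i (size P); last by rewrite nth_default.
exact: (leq_bigmax_cond (F := fun j : 'I_(size P) => absz P`_j) (Ordinal ltiP)).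
Qed.

Lemma height_leP P N :
  (forall i, (i < size P)%N -> (absz (P`_i)%R <= N)%N) -> (height P <= N)%N.
Proof. by move=> PN; apply/bigmax_leqP => i _; apply: PN. Qed.

Lemma height_coefR (R : realType) (X : R) P i :
  (height P)%:R <= X -> `|(P`_i)%:~R : R| <= X.
Proof.
apply: le_trans; rewrite -intr_norm -abszE -pmulrn ler_nat.
exact: height_coef.
Qed.

Lemma intr_ge1 (R : realType) (k : int) : k != 0 -> 1 <= `|k%:~R : R|.
Proof. by move=> k0; rewrite -intr_norm ler1z; lia. Qed.

Lemma size_polyZQ P : size (polyZQ P) = size P.
Proof.
have [->|P_neq0] := eqVneq P 0; first by rewrite /polyZQ rmorph0 !size_poly0.
by apply: size_map_poly_id0; rewrite intr_eq0 lead_coef_eq0.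
Qed.

Lemma polyZQ_eq0 P : (polyZQ P == 0) = (P == 0).
Proof. by rewrite -!size_poly_eq0 size_polyZQ. Qed.

(** In characteristic 0 the derivative of a nonconstant polynomial is nonzero and
    of smaller degree, so an irreducible polynomial cannot divide it. *)
Lemma irreducible_separable (p : {poly rat}) :
  irreducible_poly p -> separable_poly p.
Proof.
case=> p_gt1 irr_p; rewrite unlock /coprimep.
apply/negPn/negP => g_neq1.
have p_neq0 : p != 0 by rewrite -size_poly_gt0 ltnW.
have := irr_p _ g_neq1 (dvdp_gcdl p p^`()) => eqp_gp.
have : p %| p^`() by rewrite -(eqp_dvdl _ eqp_gp) dvdp_gcdr.
(* The coefficient of degree deg p - 1 in p' is deg p times the leading one. *)
have p'_neq0 : p^`() != 0.
  apply/negP => /eqP /(congr1 (fun r : {poly rat} => r`_(size p).-2)) /eqP.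
  rewrite coef0 coef_deriv mulrn_eq0 /= -[(size p).-2.+1]/((size p).-1.-1.+1).
  by rewrite prednK -1?ltnS ?(ltn_predK p_gt1) // -/(lead_coef p) lead_coef_eq0 (negPf p_neq0).
by move=> /(dvdp_leq p'_neq0); rewrite leqNgt lt_size_deriv.
Qed.

Lemma irr_sub_sep : (irr_polys `<=` sep_polys)%classic.
Proof. by move=> P; exact: irreducible_separable. Qed.

Lemma irr_of_size2 P : size P = 2 -> irr_polys P.
Proof.
move=> sP; split; first by rewrite size_polyZQ sP.
move=> q q_neq1 q_dvd.
have P_neq0 : polyZQ P != 0 by rewrite -size_poly_gt0 size_polyZQ sP.
have q_neq0 : q != 0 by apply: contraNneq P_neq0 => q0; rewrite -dvd0p -q0.
rewrite -dvdp_size_eqp //; have := dvdp_leq P_neq0 q_dvd.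
move: q_neq1 q_neq0; rewrite -size_poly_gt0 size_polyZQ sP.
by case: (size q) => [|[|[|k]]].
Qed.

Section Evaluation.
Variables (R : realType) (xi : R).

Lemma eval_abs_gt0 P : transcendental xi -> P != 0 -> 0 < eval_abs xi P.
Proof.
move=> tr_xi P_neq0; rewrite normr_gt0; apply/negP => /eqP P_xi.
apply: tr_xi; exists (polyZQ P); first by rewrite polyZQ_eq0.
rewrite /polyZQ -map_poly_comp /root (_ : map_poly _ _ = map_poly intr P) ?P_xi//.
by apply: eq_map_poly => k /=; rewrite ratr_int.
Qed.

Lemma eval_wide n P : (size P <= n)%N ->
  eval_abs xi P = `|\sum_(i < n) (P`_i)%:~R * xi ^+ i|.
Proof.
move=> sP; rewrite /eval_abs (horner_coef_wide _ (n := n)) //.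
  by congr `|_|; apply: eq_bigr => i _; rewrite coef_map.
by apply: leq_trans sP; exact: size_poly.
Qed.

(** A positive bound exists because only finitely many integer polynomials have
    bounded degree and height.  It makes the infimum in [min_value] positive,
    and forces the denominators of good approximations to be large. *)
Lemma eval_abs_bounded_below n N : transcendental xi ->
  exists2 eta : R, 0 < eta & forall P, P != 0 -> (size P <= n)%N ->
    (height P <= N)%N -> eta <= eval_abs xi P.
Proof.
move=> tr_xi.
(* Coefficients in [-N, N] are encoded as ordinals shifted by N. *)
pose F (f : {ffun 'I_n -> 'I_(N + N).+1}) : {poly int} :=
  \sum_(i < n) ((f i)%:Z - N%:Z) *: 'X^i.
pose g f := if F f == 0 then 1 else eval_abs xi (F f).
(* The default value 1 keeps the minimum positive when F f = 0. *)
exists (\big[Num.min/1]_f g f).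
  elim/big_ind: _ => // [x y x0 y0|f _]; first by rewrite lt_min x0.
  by rewrite /g; case: ifPn => // /(eval_abs_gt0 tr_xi).
move=> P P_neq0 sP hP.
pose f := [ffun i : 'I_n => inord (absz (P`_i + N%:Z)) : 'I_(N + N).+1].
have FE : F f = P.
  transitivity (\poly_(i < n) P`_i); last first.
    apply/polyP => k; rewrite coef_poly; case: ltnP => // lenk.
    by rewrite nth_default // (leq_trans sP).
  rewrite poly_def; apply: eq_bigr => i _; congr (_ *: _).
  by have := height_coef P i; rewrite ffunE => hi; rewrite inordK; lia.
have -> : eval_abs xi P = g f by rewrite /g FE (negPf P_neq0).
exact: bigmin_le_cond.
Qed.

End Evaluation.
End IntegerPolynomials.

(** * Dirichlet's theorem *)

Section Dirichlet.
Local Open Scope ring_scope.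

(** Pigeonhole: the (N+1)^(n+1) polynomials with coefficients in [0, N] take their
    values in ]-N S, N S[; cutting it into N^(n+1) boxes puts two of them in the
    same box, and their difference is the required polynomial. *)
Lemma dirichlet (R : realType) (xi : R) (n : nat) :
  exists2 C : R, 0 < C & forall N : nat, (0 < N)%N ->
    exists P : {poly int}, [/\ P != 0, (size P <= n.+1)%N, (height P <= N)%N
                & eval_abs xi P <= C / N%:R ^+ n].
Proof.
(* The extra 1 makes the bound on the values strict, so that no value falls on
   the right end of the last box. *)
pose S : R := 1 + \sum_(i < n.+1) `|xi| ^+ i.
have S_gt0 : 0 < S by rewrite ltr_pwDl// sumr_ge0// => i _; exact: exprn_ge0.
exists (2 * S); first by rewrite mulr_gt0.
move=> N N_gt0; have NR_gt0 : 0 < N%:R :> R by rewrite ltr0n.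
pose F (f : {ffun 'I_n.+1 -> 'I_N.+1}) : {poly int} :=
  \poly_(i < n.+1) (f (inord i))%:Z.
pose v (f : {ffun 'I_n.+1 -> 'I_N.+1}) : R := \sum_(i < n.+1) (f i)%:R * xi ^+ i.
have v_lt f : `|v f| < N%:R * S.
  have : `|v f| <= N%:R * \sum_(i < n.+1) `|xi| ^+ i.
    rewrite (le_trans (ler_norm_sum _ _ _)) // mulr_sumr ler_sum // => i _.
    rewrite normrM normrX normr_nat ler_wpM2r ?exprn_ge0 // ler_nat.
    exact: leq_ord.
  by move/le_lt_trans; apply; rewrite ltr_pM2l // /S ltrDr.
pose M := (N ^ n.+1)%N.
have MR_gt0 : 0 < M%:R :> R by rewrite ltr0n expn_gt0 N_gt0.
(* y rescales the range of values to [0, M[; its integer part is the box. *)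
pose y f := (v f + N%:R * S) / (2 * S * N%:R) * M%:R.
have d_gt0 : 0 < 2 * S * N%:R by rewrite !mulr_gt0.
have y_ge0 f : 0 <= y f.
  have := v_lt f; rewrite ltr_norml => /andP[lo _].
  by rewrite mulr_ge0 ?divr_ge0 ?ltW //; lra.
have y_lt f : y f < M%:R.
  have := v_lt f; rewrite ltr_norml => /andP[_ hi].
  by rewrite gtr_pMl // ltr_pdivrMr // mul1r; lra.
have box_lt f : (Num.truncn (y f) < M)%N by rewrite truncn_lt_nat.
pose box f := Ordinal (box_lt f).
have /injectivePn[f [g fNg box_fg]] : ~~ injectiveb box.
  apply/negP => /injectiveP/leq_card.
  by rewrite card_ffun !card_ord leqNgt ltn_exp2r // ltnSn.
have vE h : eval_abs xi (F h) = `|v h|.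
  rewrite (@eval_wide _ _ n.+1) ?size_poly //; congr `|_|.
  by apply: eq_bigr => i _; rewrite coef_poly ltn_ord inord_val.
pose D : {poly int} := F f - F g; exists D.
have coefD (i : nat) : (i < n.+1)%N ->
    D`_i = (f (inord i))%:Z - (g (inord i))%:Z.
  by move=> lti; rewrite [LHS]coefB !coef_poly lti.
have sB : (size D <= n.+1)%N.
  by rewrite (leq_trans (size_polyD _ _)) // size_polyN geq_max !size_poly.
split=> //.
- apply: contraNneq fNg => B0; apply/eqP/ffunP => i; apply/val_inj.
  have := coefD i (ltn_ord i); rewrite B0 coef0 inord_val => /esym/eqP; rewrite subr_eq0 => /eqP [E]; exact: E.
- apply: height_leP => i /leq_trans/(_ sB) lti; rewrite coefD //.
  by have := ltn_ord (f (inord i)); have := ltn_ord (g (inord i)); lia.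
- rewrite (@eval_wide _ _ n.+1) //.
  have -> : \sum_(i < n.+1) (D`_i)%:~R * xi ^+ i = v f - v g.
    rewrite -sumrB; apply: eq_bigr => i _.
    by rewrite coefD // inord_val rmorphB /= mulrBl.
  have box_eq : Num.truncn (y f) = Num.truncn (y g) := congr1 val box_fg.
  have y_close : `|y f - y g| < 1.
    have := truncn_itv (y_ge0 f); have := truncn_itv (y_ge0 g).
    rewrite box_eq -natr1 => /andP[g1 g2] /andP[f1 f2].
    by rewrite ltr_norml; apply/andP; split; lra.
  have vyE : v f - v g = (y f - y g) * (2 * S / N%:R ^+ n).
    rewrite /y /M natrX exprS; field.
    by rewrite expf_neq0 ?(gt_eqF NR_gt0) ?(gt_eqF S_gt0).
  have c_gt0 : 0 < 2 * S / N%:R ^+ n by rewrite divr_gt0 ?exprn_gt0 ?mulr_gt0.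
  by rewrite vyE normrM (gtr0_norm c_gt0) ler_piMl ?ltW.
Qed.

End Dirichlet.

(** * Bounding the exponents by bounding values *)

Section ExponentBounds.
Local Open Scope ring_scope.
Variables (R : realType) (xi : R).
Hypothesis tr_xi : transcendental xi.
Implicit Types (K : set {poly int}) (X s w : R) (n : nat).

(** The infimum of the empty set is 0 by convention, so bounds on [w_at] from
    above need a witness that the infimum ranges over a nonempty set. *)
Lemma polyX_admissible K n X : (irr_polys `<=` K)%classic -> (0 < n)%N -> 1 <= X ->
  admissible K n X 'X.
Proof.
move=> irrK n_gt0 X_ge1; split.
- by apply: irrK; apply: irr_of_size2; rewrite size_polyX.
- by rewrite polyX_eq0.
- by rewrite size_polyX ltnS.
- rewrite (le_trans _ X_ge1) // lern1; apply: height_leP => i _.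
  by rewrite coefX; case: (i == 1)%N.
Qed.

Lemma eval_lbounded K n X : has_lbound (eval_abs xi @` admissible K n X)%classic.
Proof. by exists 0 => _ [P _ <-]; exact: normr_ge0. Qed.

Lemma min_value_gt0 K n X : (admissible K n X !=set0)%classic ->
  0 < min_value K n xi X.
Proof.
move=> [P0 P0X].
have [eta eta_gt0 etaP] := eval_abs_bounded_below n.+1 (Num.truncn X) tr_xi.
apply: (lt_le_trans eta_gt0); apply: lb_le_inf; first by exists (eval_abs xi P0), P0.
move=> _ [P [KP P_neq0 sP hP] <-]; apply: etaP => //.
by rewrite truncn_ge_nat // (le_trans _ hP).
Qed.

Lemma w_at_ge K n X s P : 1 < X -> admissible K n X P ->
  ln (eval_abs xi P) <= - (s * ln X) -> s <= w_at K n xi X.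
Proof.
move=> X_gt1 adm le_s; rewrite /w_at ler_pdivlMr ?ln_gt0 // lerNr.
apply: le_trans le_s.
have min_gt0 : 0 < min_value K n xi X by apply: min_value_gt0; exists P.
have min_le : min_value K n xi X <= eval_abs xi P.
  by apply: ge_inf; [exact: eval_lbounded | exists P].
by rewrite ler_ln // posrE // (lt_le_trans min_gt0).
Qed.

Lemma w_at_le K n X s : 1 < X -> (admissible K n X !=set0)%classic ->
  (forall P, admissible K n X P -> - (s * ln X) <= ln (eval_abs xi P)) ->
  w_at K n xi X <= s.
Proof.
move=> X_gt1 adm0 le_s; rewrite /w_at ler_pdivrMr ?ln_gt0 // lerNl.
have min_gt0 := min_value_gt0 adm0.
rewrite -ler_expR (lnK min_gt0); apply: lb_le_inf.
  by case: adm0 => P PX; exists (eval_abs xi P), P.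
move=> _ [P PX <-]; have [_ P_neq0 _ _] := PX.
have P_gt0 := eval_abs_gt0 tr_xi P_neq0.
by rewrite -(lnK P_gt0) ler_expR le_s.
Qed.

Lemma w_at_gt_witness K n X w : 1 < X -> (admissible K n X !=set0)%classic ->
  w < w_at K n xi X ->
  exists2 P, admissible K n X P & ln (eval_abs xi P) < - (w * ln X).
Proof.
move=> X_gt1 adm0 w_lt; apply: contrapT => noP.
suff : w_at K n xi X <= w by rewrite leNgt w_lt.
apply: w_at_le => // P PX; rewrite leNgt; apply/negP => lnP.
by apply: noP; exists P.
Qed.

(** Heights bounded by integers N suffice: for real X take N to be its integer
    part, which is at least X/2, so that only the constant C changes. *)
Lemma w_hat_ge K n m (C : R) (N0 : nat) : 0 < C ->
  (forall N, (N0 <= N)%N -> (0 < N)%N ->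
     exists P : {poly int}, [/\ K P, P != 0, (size P <= n.+1)%N, (height P <= N)%N
                 & eval_abs xi P <= C / N%:R ^+ m]) ->
  (m%:R%:E <= w_hat K n xi)%E.
Proof.
move=> C_gt0 small; apply/lee_subgt0Pr => e e_gt0.
rewrite /w_hat limf_einfE; apply: ereal_sup_ge.
(* Above expR B the constants ln C and m ln 2 weigh less than e ln X. *)
pose B := (ln C + m%:R * ln 2) / e.
pose A := Num.max (Num.max 2 N0%:R) (expR B).
pose V : set R := [set X | A < X]%classic.
exists (ereal_inf ((fun X => (w_at K n xi X)%:E) @` V)%classic).
  by exists V => //; exact: (nbhs_pinfty_gt (num_real A)).
apply: le_ereal_inf_tmp => _ [X /= + <-].
rewrite /V /A /= !gt_max => /andP[/andP[X_gt2 X_gtN0] X_gtB].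
have X_gt0 : 0 < X by rewrite (lt_trans _ X_gt2).
pose N := Num.truncn X.
have /andP[NX XN] := truncn_itv (ltW X_gt0).
have N_gt0 : (0 < N)%N by rewrite truncn_gt0; lra.
have N0N : (N0 <= N)%N by rewrite truncn_ge_nat ltW.
have [P [KP P_neq0 sP hP evP]] := small N N0N N_gt0.
rewrite -EFinB lee_fin; apply: (@w_at_ge _ _ _ _ P); first by lra.
  by split=> //; apply: le_trans NX; rewrite ler_nat.
have P_gt0 := eval_abs_gt0 tr_xi P_neq0.
have NR_gt0 : 0 < N%:R :> R by rewrite ltr0n.
have lnP : ln (eval_abs xi P) <= ln C - m%:R * ln N%:R.
  move: evP; rewrite -ler_ln ?posrE ?divr_gt0 ?exprn_gt0 //.
  by rewrite lnM ?posrE ?invr_gt0 ?exprn_gt0 // lnV ?posrE ?exprn_gt0 // lnXn // mulr_natl.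
have lnX : ln X <= ln 2 + ln N%:R.
  rewrite -lnM ?posrE // ler_ln ?posrE ?mulr_gt0 //.
  have : 1 <= N%:R :> R by rewrite ler1n.
  by move: XN; rewrite -natr1 -/N; lra.
have lnXB : ln C + m%:R * ln 2 <= e * ln X.
  have : B <= ln X by rewrite -ler_expR (lnK X_gt0) ltW.
  by rewrite ler_pdivrMr // [_ * e]mulrC.
have : m%:R * ln X <= m%:R * (ln 2 + ln N%:R) by rewrite ler_wpM2l.
lra.
Qed.

Lemma w_hat_le K n s :
  (forall A, exists2 X, A < X & w_at K n xi X <= s) ->
  (w_hat K n xi <= s%:E)%E.
Proof.
move=> often; rewrite /w_hat limf_einfE; apply: ge_ereal_sup => _ [V Voo <-].
have [A [_ AV]] := Voo.
have [X AX wX] := often A.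
apply: ereal_inf_le; exists (w_at K n xi X)%:E => //.
by exists X => //; exact: AV.
Qed.

Lemma w_sup_gt n w : (w%:E < w_sup n xi)%E ->
  forall A, exists2 X, A < X & w < w_at any_polys n xi X.
Proof.
move=> w_lt A.
pose V : set R := [set X | A < X]%classic.
have : (w%:E < ereal_sup ((fun X => (w_at any_polys n xi X)%:E) @` V)%classic)%E.
  apply: (lt_le_trans w_lt); rewrite /w_sup limf_esupE; apply: ereal_inf_lbound.
  by exists V => //; exact: (nbhs_pinfty_gt (num_real A)).
by move=> /ereal_sup_gt[_ [X AX <-]]; rewrite lte_fin; exists X.
Qed.

End ExponentBounds.

(** * Rational approximations from the exponent of degree one *)

Section RationalApproximation.
Local Open Scope ring_scope.
Variables (R : realType) (xi : R).
Hypothesis tr_xi : transcendental xi.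

(** The factor k is the content of b X + a, with the sign that makes the leading
    coefficient of the primitive part q X - p positive. *)
Lemma coprime_factor (a b : int) : b != 0 ->
  exists k p q : int, [/\ 0 < q, coprimez q p, k != 0, b = k * q & a = - (k * p)].
Proof.
move=> b_neq0.
have g_neq0 : gcdz b a != 0 by rewrite gcdz_eq0 negb_and b_neq0.
have [s s_def s_b] : exists2 s : int, s * s = 1 & 0 < s * b.
  by have [b_gt0|b_lt0|/eqP] := ltrgt0P b; [exists 1 | exists (-1) |]; lia.
exists (s * gcdz b a), (- s * (a %/ gcdz b a)%Z), (s * (b %/ gcdz b a)%Z).
have bE := divzK (dvdz_gcdl b a); have aE := divzK (dvdz_gcdr b a).
set g := gcdz b a in g_neq0 bE aE *.
set b' := (b %/ g)%Z in bE *; set a' := (a %/ g)%Z in aE *.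
have g_gt0 : 0 < g by rewrite lt_def g_neq0 /g /gcdz.
split.
- by have : 0 < (s * b') * g by [rewrite -mulrA bE]; rewrite pmulr_lgt0.
- have : gcdz (b' * g) (a' * g) = g by rewrite bE aE.
  rewrite -mulz_gcdl => gE.
  have co : coprimez b' a'.
    apply/eqP; apply: (mulIf g_neq0); move: gE.
    by rewrite mul1r gez0_abs // ltW.
  rewrite mulNr coprimezN.
  have [->|->] : s = 1 \/ s = -1 by nia.
    by rewrite !mul1r.
  by rewrite !mulN1r coprimezN coprimeNz.
- by rewrite mulf_neq0 //; apply/eqP => s0; move: s_def; rewrite s0 mul0r.
- by rewrite mulrACA s_def mul1r mulrC bE.
- by rewrite mulNr mulrN opprK mulrACA s_def mul1r mulrC aE.
Qed.

Lemma linear_eval (P : {poly int}) : (size P <= 2)%N ->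
  eval_abs xi P = `|(P`_1)%:~R * xi + (P`_0)%:~R|.
Proof.
move=> sP; rewrite (eval_wide xi sP) !big_ord_recl big_ord0 /=.
by rewrite expr0 mulr1 addr0 expr1 addrC.
Qed.

(** A linear polynomial with a very small value at xi may be replaced by its
    primitive part q X - p, which has smaller value and height.  Its denominator
    q exceeds N, since the polynomials q X - p with q <= N and |q xi - p| < 1
    have bounded height, and so their values are bounded away from 0.  The
    inequality |q xi - p| <= q^-w is stated through logarithms. *)
Lemma good_rational_approximation (w : R) (N : nat) : 1 <= w ->
  (w%:E < w_sup 1 xi)%E ->
  exists p q : int, [/\ N%:Z < q, coprimez q p, 0 < `|q%:~R * xi - p%:~R|
    & w * ln q%:~R <= - ln `|q%:~R * xi - p%:~R|].
Proof.
move=> w_ge1 w_lt.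
(* M bounds |p| as soon as q <= N and |q xi - p| <= 1. *)
pose M := (Num.truncn (N%:R * `|xi| + 1) + N)%N.
have [eta eta_gt0 eta_le] := eval_abs_bounded_below 2 M tr_xi.
have [X] := w_sup_gt w_lt (Num.max 1 (expR (- ln eta))).
rewrite gt_max => /andP[X_gt1 X_gt] w_ltX.
have X_gt0 : 0 < X by lra.
have X1 : admissible any_polys 1 X 'X by apply: polyX_admissible => //; exact: ltW.
have [P [_ P_neq0 sP hP] lnP] :=
  w_at_gt_witness tr_xi X_gt1 (ex_intro _ _ X1) w_ltX.
have evP_gt0 := eval_abs_gt0 tr_xi P_neq0.
have lnX_gt0 : 0 < ln X by rewrite ln_gt0.
have lnX_wln : ln X <= w * ln X by rewrite ler_peMl // ltW.
have evP_lt1 : eval_abs xi P < 1.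
  by rewrite -(ltr_ln evP_gt0 ltr01) ln1; lra.
have evP_lt_eta : eval_abs xi P < eta.
  rewrite -(ltr_ln evP_gt0 eta_gt0).
  have : - ln eta < ln X by rewrite -ltr_expR (lnK X_gt0).
  lra.
(* A nonzero integer constant has absolute value at least 1. *)
have P1_neq0 : P`_1 != 0.
  apply/eqP => P1_eq0; move: evP_lt1; rewrite linear_eval // P1_eq0 mul0r add0r.
  apply/negP; rewrite -leNgt intr_ge1 //; apply: contraNneq P_neq0 => P0_eq0.
  apply/eqP/polyP => i; rewrite coef0; case: i => [|[|i]] //.
  by rewrite nth_default // (leq_trans sP).
have [k [p [q [q_gt0 co k_neq0 P1E P0E]]]] := coprime_factor P`_0 P1_neq0.
set d := `|q%:~R * xi - p%:~R|.
have k_ge1 := intr_ge1 R k_neq0.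
have evPE : eval_abs xi P = `|k%:~R| * d.
  rewrite linear_eval // P1E P0E -normrM; congr `|_|.
  by rewrite rmorphN /= !rmorphM /=; ring.
have d_gt0 : 0 < d.
  by rewrite -(pmulr_rgt0 (x := `|k%:~R|)) -?evPE //; lra.
have d_le : d <= eval_abs xi P by rewrite evPE ler_peMl // ltW.
have qR_ge1 : 1 <= q%:~R :> R by rewrite ler1z -gtz0_ge1.
exists p, q; split=> //.
- rewrite ltNge; apply/negP => q_leN.
  (* L = q X - p would contradict the choice of eta. *)
  pose L : {poly int} := \poly_(i < 2) (if i == 0%N then - p else q).
  have L1 : L`_1 = q by rewrite coef_poly.
  have L0 : L`_0 = - p by rewrite coef_poly.
  have L_neq0 : L != 0.
    by apply: contraTneq q_gt0 => L_eq0; rewrite -L1 L_eq0 coef0.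
  have sL : (size L <= 2)%N by exact: size_poly.
  have evL : eval_abs xi L = d by rewrite linear_eval // L1 L0 rmorphN.
  have hL : (height L <= M)%N.
    apply: height_leP => i /leq_trans/(_ sL).
    case: i => [|[|]] // _; last first.
      rewrite L1 (leq_trans _ (leq_addl _ _)) //.
      by clear -q_gt0 q_leN; lia.
    rewrite L0 /M (@leq_trans (Num.truncn (N%:R * `|xi| + 1))) ?leq_addr //.
    rewrite truncn_ge_nat ?addr_ge0 ?mulr_ge0 //.
    rewrite pmulrn abszE normrN intr_norm.
    have -> : p%:~R = q%:~R * xi - (q%:~R * xi - p%:~R) :> R by ring.
    rewrite (le_trans (ler_normB _ _)) // lerD //.
      rewrite normrM ler_wpM2r // ger0_norm; last by lra.
      by rewrite -[N%:R]/(N%:Z%:~R) ler_int.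
    by rewrite -/d; lra.
  by have := eta_le L L_neq0 sL hL; rewrite evL; lra.
- have lnd : ln d <= ln (eval_abs xi P) by rewrite ler_ln.
  have lnq : ln q%:~R <= ln X.
    rewrite ler_ln ?posrE //; last by lra.
    have := height_coefR 1 hP; rewrite P1E rmorphM normrM /=.
    apply: le_trans; rewrite (ger0_norm (x := q%:~R)); last by lra.
    by rewrite ler_peMl //; lra.
  have : w * ln q%:~R <= w * ln X by rewrite ler_wpM2l //; lra.
  by rewrite -/d; lra.
Qed.

End RationalApproximation.


(** * Quadratic polynomials near a rational point *)

Section QuadraticsNearRationals.
Local Open Scope ring_scope.
Implicit Types P : {poly int}.

(** This is q^2 P(p/q) when P has degree at most 2. *)
Definition homogenized (P : {poly int}) (p q : int) : int :=
  P`_2 * p ^+ 2 + P`_1 * p * q + P`_0 * q ^+ 2.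

(** The rational root theorem for the leading coefficient: q divides
    P_2 p^2 and is coprime to p. *)
Lemma homogenized_root_dvd P p q : coprimez q p -> homogenized P p q = 0 ->
  (q %| P`_2)%Z.
Proof.
move=> co r0; rewrite -(@Gauss_dvdzl q _ (p ^+ 2)) ?coprimezXr //.
apply/dvdzP; exists (- (P`_1 * p + P`_0 * q)).
by move: r0; rewrite /homogenized => r0; lia.
Qed.

(** If P vanishes at p/q then q divides P_2, which is smaller than q and so equal
    to 0; the same argument then kills P_1, and P_0 follows. *)
Lemma small_height_homogenized_neq0 P p q : coprimez q p -> P != 0 ->
  (size P <= 3)%N -> (height P)%:Z < q -> homogenized P p q != 0.
Proof.
move=> co P_neq0 sP hq; apply/negP => /eqP r0.
have small i : (q %| P`_i)%Z -> P`_i = 0.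
  have := height_coef P i => hi /dvdzP[m mE].
  have [m0|m_neq0] := eqVneq m 0; first by rewrite mE m0 mul0r.
  have : (absz m * absz q <= height P)%N by rewrite -abszM -mE.
  have : (0 < absz m)%N by rewrite absz_gt0.
  by clear -hq; nia.
have P2 := small _ (homogenized_root_dvd co r0).
have q_neq0 : q != 0 by lia.
have r1 : P`_1 * p = - P`_0 * q.
  by apply: (mulIf q_neq0); move: r0; rewrite /homogenized P2; lia.
have P1 : P`_1 = 0.
  apply: small; rewrite -(@Gauss_dvdzl q _ p) // r1.
  by apply/dvdzP; exists (- P`_0).
have P0 : P`_0 = 0 by move: r1; rewrite P1; nia.
case/eqP: P_neq0; apply/polyP => i; rewrite coef0.
by case: i => [|[|[|i]]] //; rewrite nth_default // (leq_trans sP).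
Qed.

(** The integer in the conclusion is q P'(p/q), and a separable polynomial has
    no common root with its derivative. *)
Lemma separable_simple_root P p q : q != 0 -> sep_polys P -> (size P <= 3)%N ->
  homogenized P p q = 0 -> 2 * P`_2 * p + P`_1 * q != 0.
Proof.
rewrite /sep_polys /= unlock => q_neq0 sepP sP r0; apply/negP => /eqP r1.
pose x : rat := p%:~R / q%:~R.
have qQ : q%:~R != 0 :> rat by rewrite intr_eq0.
have sQ : (size (polyZQ P) <= 3)%N by rewrite size_polyZQ.
have root_x : root (polyZQ P) x.
  rewrite /root (horner_coef_wide _ sQ) !big_ord_recl big_ord0 /= !coef_map /=.
  have := congr1 (fun k : int => k%:~R / q%:~R ^+ 2 : rat) r0.
  rewrite /homogenized !rmorphD /= !rmorphM /= ?rmorphXn /= mul0r => E.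
  by apply/eqP; rewrite -[RHS]E /x /bump /=; field.
have := coprimep_root sepP root_x; apply/negP; rewrite negbK.
have sQ' : (size (polyZQ P)^`() <= 2)%N.
  by rewrite (leq_trans (size_poly _ _)) //; case: (size _) sQ.
rewrite (horner_coef_wide _ sQ') !big_ord_recl big_ord0 /= !coef_deriv !coef_map /=.
have := congr1 (fun k : int => k%:~R / q%:~R : rat) r1.
rewrite !rmorphD /= !rmorphM /= mul0r => E; apply/eqP; rewrite -[RHS]E.
by rewrite /x /bump /=; field.
Qed.

Variables (R : realType) (xi : R).

Lemma quadratic_taylor P p q : q != 0 -> (size P <= 3)%N ->
  let x := xi - p%:~R / q%:~R in
  eval_abs xi P = `|(homogenized P p q)%:~R / q%:~R ^+ 2
    + x * ((2 * P`_2 * p + P`_1 * q)%:~R / q%:~R + (P`_2)%:~R * x)|.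
Proof.
move=> q_neq0 sP x; have qR : q%:~R != 0 :> R by rewrite intr_eq0.
rewrite (eval_wide xi sP) !big_ord_recl big_ord0 /=; congr `|_|.
rewrite /homogenized /x !rmorphD /= !rmorphM /= ?rmorphXn /= /bump /=.
by field.
Qed.

Variables (p q : int).
Hypothesis q_gt0 : 0 < q.
Let d := `|q%:~R * xi - p%:~R|.
Let C := 2 * `|xi| + 2.

Let qR_ge1 : 1 <= q%:~R :> R.
Proof. by rewrite ler1z -gtz0_ge1. Qed.

Let distE : `|xi - p%:~R / q%:~R| = d / q%:~R.
Proof.
have q_neq0 : q%:~R != 0 :> R by rewrite gt_eqF // ltr0z.
have -> : xi - p%:~R / q%:~R = (q%:~R * xi - p%:~R) / q%:~R by field.
by rewrite normrM normfV (ger0_norm (x := q%:~R)) // ler0z ltW.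
Qed.

(** The first term bounds |P(p/q)| from below, because q^2 P(p/q) is a nonzero
    integer; the second one bounds |P(xi) - P(p/q)| from above. *)
Lemma nonroot_lower_bound P X : d <= 1 -> (size P <= 3)%N ->
  (height P)%:R <= X -> homogenized P p q != 0 ->
  (q%:~R ^+ 2)^-1 - C * X * d / q%:~R <= eval_abs xi P.
Proof.
move=> d_le1 sP hP r_neq0.
rewrite (@quadratic_taylor P p q) //; last by lia.
set x := xi - _; have x_d : `|x| = d / q%:~R := distE.
have x_le1 : `|x| <= 1 by rewrite x_d ler_pdivrMr ?ltr0z // mul1r (le_trans d_le1).
have q2_gt0 : 0 < q%:~R ^+ 2 :> R by rewrite exprn_gt0 // ltr0z.
have r_ge : (q%:~R ^+ 2)^-1 <= `|(homogenized P p q)%:~R / q%:~R ^+ 2 : R|.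
  rewrite normrM normfV (gtr0_norm q2_gt0) ler_peMl ?invr_ge0 ?(ltW q2_gt0) //.
  exact: intr_ge1.
apply: le_trans (lerB_normD _ _); apply: lerB => //.
have -> : C * X * d / q%:~R = `|x| * (C * X) by rewrite x_d; ring.
rewrite normrM ler_wpM2l //.
have -> : (2 * P`_2 * p + P`_1 * q)%:~R / q%:~R + (P`_2)%:~R * x
    = (P`_2)%:~R * (2 * xi - x) + (P`_1)%:~R.
  have q_neq0 : q%:~R != 0 :> R by rewrite gt_eqF // ltr0z.
  by rewrite /x !rmorphD /= !rmorphM /=; field.
have X_ge0 : 0 <= X by apply: le_trans hP.
have P2 := height_coefR 2 hP; have P1 := height_coefR 1 hP.
rewrite (le_trans (ler_normD _ _)) // normrM /C.
have xi_le : `|2 * xi - x| <= 2 * `|xi| + 1.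
  by rewrite (le_trans (ler_normB _ _)) // normrM ger0_norm // lerD2l.
have := ler_pM (normr_ge0 _) (normr_ge0 _) P2 xi_le.
nra.
Qed.

(** Since q divides P_2, the derivative P'(p/q) = 2 P_2 p/q + P_1 is itself a
    nonzero integer, hence at least 1 in absolute value; knowing only that
    q P'(p/q) is an integer would lose a factor q, and the final exponent would
    be too large. *)
Lemma simple_root_lower_bound P X : coprimez q p -> (size P <= 3)%N ->
  (height P)%:R <= X -> homogenized P p q = 0 ->
  2 * P`_2 * p + P`_1 * q != 0 ->
  d / q%:~R * (1 - X * d / q%:~R) <= eval_abs xi P.
Proof.
move=> co sP hP r0 r1_neq0.
rewrite (@quadratic_taylor P p q) //; last by lia.
have q_neq0 : q%:~R != 0 :> R by rewrite gt_eqF // ltr0z.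
set x := xi - _; have x_d : `|x| = d / q%:~R := distE.
rewrite r0 mul0r add0r normrM x_d ler_wpM2l -?x_d //.
have /dvdzP[m mE] := homogenized_root_dvd co r0.
have kE : 2 * P`_2 * p + P`_1 * q = (2 * m * p + P`_1) * q by rewrite mE; ring.
have k_neq0 : 2 * m * p + P`_1 != 0.
  by apply: contraNneq r1_neq0 => k0; rewrite kE k0 mul0r.
rewrite kE rmorphM /= mulfK //.
apply: le_trans (lerB_normD _ _); apply: lerB; first exact: intr_ge1.
rewrite normrM -mulrA -x_d ler_wpM2r //; exact: height_coefR.
Qed.

End QuadraticsNearRationals.

(** * The uniform exponents *)

Section UniformExponents.
Variables (R : realType) (xi : R).
Hypothesis tr_xi : transcendental xi.
Implicit Types K : set {poly int}.

(** The condition on s says s > (w + 1)/(w - 1).  At height X = 1/(2 C q d) both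
    kinds of separable polynomials satisfy |P(xi)| >= d/(2q), and this is at
    least X^-s once q is large, because s > (w + 1)/(w - 1) and d <= q^-w. *)
Lemma w_hat_sep_le K (s w : R) :
  (irr_polys `<=` K)%classic -> (K `<=` sep_polys)%classic ->
  (1 < s)%R -> (s + 1 < w * (s - 1))%R -> w%:E < w_sup 1 xi ->
  w_hat K 2 xi <= s%:E.
Proof.
move=> irrK Ksep s_gt1 sw w_lt; apply: w_hat_le => // A.
have w_gt1 : (1 < w)%R.
  rewrite ltNge; apply/negP => w_le1.
  have : (w * (s - 1) <= 1 * (s - 1))%R by rewrite ler_wpM2r //; lra.
  lra.
pose C : R := (2 * `|xi| + 2)%R.
have C_ge2 : (2 <= C)%R by rewrite /C lerDr mulr_ge0.
have C_gt0 : (0 < C)%R by exact: lt_le_trans C_ge2.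
pose A' : R := (Num.max A 1)%R.
have A'_ge1 : (1 <= A')%R by rewrite le_max lexx orbT.
pose k : R := (w * (s - 1) - (s + 1))%R.
have k_gt0 : (0 < k)%R by rewrite subr_gt0.
(* ln q > B1 makes X exceed A and 1, and ln q > B2 gives d/(2q) >= X^-s. *)
pose B1 : R := ((ln (2 * C) + ln A') / (w - 1))%R.
pose B2 : R := ((ln 2 + s * ln (2 * C)) / k)%R.
pose N := (Num.truncn (expR (Num.max B1 B2))).+1.
have [p [q [q_gtN co d_gt0 dq]]] :=
  good_rational_approximation tr_xi N (ltW w_gt1) w_lt.
have q_gt0 : (0 < q)%R by apply: lt_trans q_gtN; rewrite ltz_nat.
set d := `|_|%R in d_gt0 dq.
set Q : R := (q%:~R)%R in d dq d_gt0.
have Q_ge1 : (1 <= Q)%R by rewrite ler1z -gtz0_ge1.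
have Q_gt0 : (0 < Q)%R by exact: lt_le_trans Q_ge1.
have lnQ_ge0 : (0 <= ln Q)%R by rewrite ln_ge0.
have [B1Q B2Q] : (B1 < ln Q /\ B2 < ln Q)%R.
  suff : (Num.max B1 B2 < ln Q)%R by rewrite gt_max => /andP.
  rewrite -ltr_expR (lnK Q_gt0) (lt_trans (truncnS_gt _)) //.
  by rewrite -/N /Q pmulrn ltr_int.
have dQ_le1 : (d * Q <= 1)%R.
  have : (1 * ln Q <= w * ln Q)%R by rewrite ler_wpM2r // ltW.
  rewrite -[X in (X <= _)%R -> _](_ : ln Q = _) ?mul1r // => lnQ_le.
  rewrite -ler_ln ?posrE ?mulr_gt0 // ln1 lnM ?posrE //; lra.
have d_le1 : (d <= 1)%R.
  by apply: le_trans dQ_le1; rewrite ler_peMr // ltW.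
have CQ_gt0 : (0 < 2 * C * Q)%R by rewrite !mulr_gt0.
pose X : R := ((2 * C * Q * d)^-1)%R.
have X_gt0 : (0 < X)%R by rewrite invr_gt0 mulr_gt0.
have lnX : ln X = (- (ln (2 * C) + ln Q + ln d))%R.
  have C2_gt0 : (0 < 2 * C)%R by rewrite mulr_gt0.
  rewrite lnV; last by rewrite posrE mulr_gt0.
  rewrite (lnM (x := 2 * C * Q)%R) ?posrE //.
  by rewrite (lnM (x := 2 * C)%R) ?posrE.
have A'X : (A' < X)%R.
  rewrite -ltr_ln ?posrE //; last by lra.
  have : (ln (2 * C) + ln A' < ln Q * (w - 1))%R.
    by rewrite -ltr_pdivrMr // subr_gt0.
  rewrite lnX; lra.
have AX : (A < X)%R by apply: le_lt_trans A'X; rewrite le_max lexx.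
have X_gt1 : (1 < X)%R by exact: le_lt_trans A'X.
exists X => //; apply: w_at_le => //.
  by exists 'X%R; apply: polyX_admissible => //; exact: ltW.
move=> P [KP P_neq0 sP hP].
have XdE : (X * d = (2 * C * Q)^-1)%R.
  by rewrite /X; field; rewrite !gt_eqF //; lra.
have lower : (d / (2 * Q) <= eval_abs xi P)%R.
  have [r0|r_neq0] := eqVneq (homogenized P p q) 0%R.
    have r1 := separable_simple_root (lt0r_neq0 q_gt0) (Ksep _ KP) sP r0.
    have := simple_root_lower_bound xi q_gt0 co sP hP r0 r1.
    apply: le_trans; rewrite -/Q -/d XdE.
    have -> : (d / (2 * Q) = d / Q * 2^-1)%R by field; rewrite gt_eqF.
    rewrite ler_wpM2l ?divr_ge0 ?(ltW Q_gt0) ?(ltW d_gt0) //.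
    have : ((2 * C * Q)^-1 / Q <= 2^-1)%R.
      rewrite -invfM lef_pV2 ?posrE ?mulr_gt0 //.
      have : (1 <= Q * Q)%R by rewrite mulr_ege1.
      nra.
    lra.
  have := nonroot_lower_bound q_gt0 d_le1 sP hP r_neq0.
  apply: le_trans; rewrite -/C -/Q -/d.
  have -> : ((Q ^+ 2)^-1 - C * X * d / Q = 1 / (2 * Q) / Q)%R.
    rewrite -(mulrA C) XdE; field; rewrite !gt_eqF //; lra.
  have -> : (d / (2 * Q) = d * Q / (2 * Q) / Q)%R by field; rewrite gt_eqF.
  by rewrite !ler_pM2r ?invr_gt0 ?mulr_gt0.
have lnlower : (ln d - ln 2 - ln Q <= ln (eval_abs xi P))%R.
  rewrite -addrA -opprD -lnM ?posrE // -lnV ?posrE ?mulr_gt0 //.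
  rewrite -lnM ?posrE ?invr_gt0 ?mulr_gt0 // ler_ln ?posrE //.
    by rewrite divr_gt0 ?mulr_gt0.
  exact: eval_abs_gt0.
apply: le_trans lnlower; rewrite lnX.
have B2k : (ln 2 + s * ln (2 * C) < ln Q * k)%R by rewrite -ltr_pdivrMr.
have : ((s - 1) * (w * ln Q) <= (s - 1) * - ln d)%R by rewrite ler_wpM2l //; lra.
move: B2k; rewrite /k; lra.
Qed.

(** At height X = q/2 no nonzero polynomial of degree at most 2 vanishes at p/q.
    The exponent 3 makes d at most q^-3, so that for q > C the error term
    C X d / q is at most half of the main term q^-2. *)
Lemma w_hat_any_le (s : R) : (2 < s)%R -> 3%:E < w_sup 1 xi ->
  w_hat any_polys 2 xi <= s%:E.
Proof.
move=> s_gt2 w_lt; apply: w_hat_le => // A.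
pose C : R := (2 * `|xi| + 2)%R.
have C_ge2 : (2 <= C)%R by rewrite /C lerDr mulr_ge0.
pose A' : R := (Num.max A 1)%R.
have A'_ge1 : (1 <= A')%R by rewrite le_max lexx orbT.
(* ln q > B absorbs the constants in q^-2 / 2 >= (q/2)^-s. *)
pose B : R := ((s + 1) * ln 2 / (s - 2))%R.
pose N := (Num.truncn (Num.max (Num.max C (2 * A')%R) (expR B))).+1.
have three_ge1 : (1 <= 3 :> R)%R by lra.
have [p [q [q_gtN co d_gt0 dq]]] :=
  good_rational_approximation tr_xi N three_ge1 w_lt.
have q_gt0 : (0 < q)%R by apply: lt_trans q_gtN; rewrite ltz_nat.
set d := `|_|%R in d_gt0 dq.
set Q : R := (q%:~R)%R in d dq d_gt0.
have Q_ge1 : (1 <= Q)%R by rewrite ler1z -gtz0_ge1.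
have Q_gt0 : (0 < Q)%R by exact: lt_le_trans Q_ge1.
have lnQ_ge0 : (0 <= ln Q)%R by rewrite ln_ge0.
have : (Num.max (Num.max C (2 * A')) (expR B) < Q)%R.
  rewrite (lt_trans (truncnS_gt _)) //.
  by rewrite -/N /Q pmulrn ltr_int.
rewrite !gt_max => /andP[/andP[CQ A'Q] BQ].
have dQ3_le1 : (d * Q ^+ 3 <= 1)%R.
  rewrite -ler_ln ?posrE ?mulr_gt0 ?exprn_gt0 // ln1 lnM ?posrE ?exprn_gt0 //.
  by rewrite lnXn // -mulr_natl; lra.
have d_le1 : (d <= 1)%R.
  by apply: le_trans dQ3_le1; rewrite ler_peMr ?(ltW d_gt0) // exprn_ege1.
pose X : R := (Q / 2)%R.
have AX : (A < X)%R.
  have : (A <= A')%R by rewrite le_max lexx.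
  by rewrite /X; lra.
have X_gt1 : (1 < X)%R by rewrite /X; lra.
exists X => //; apply: w_at_le => //.
  by exists 'X%R; apply: polyX_admissible => //; exact: ltW.
move=> P [_ P_neq0 sP hP].
have r_neq0 : homogenized P p q != 0%R.
  apply: small_height_homogenized_neq0 => //.
  rewrite -(ltr_int R) -pmulrn (le_lt_trans hP) // -/Q /X.
  lra.
have lower : ((2 * Q ^+ 2)^-1 <= eval_abs xi P)%R.
  have := nonroot_lower_bound q_gt0 d_le1 sP hP r_neq0.
  apply: le_trans; rewrite -/C -/Q -/d.
  have -> : (C * X * d / Q = C * d / 2)%R by rewrite /X; field; rewrite gt_eqF.
  have -> : ((2 * Q ^+ 2)^-1 = (Q ^+ 2)^-1 / 2)%R by field; rewrite gt_eqF.
  have : (C * d <= (Q ^+ 2)^-1)%R.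
    apply: (@le_trans _ _ (Q * d)%R); first by rewrite ler_wpM2r ?ltW.
    rewrite -[leRHS]mul1r ler_pdivlMr ?exprn_gt0 //.
    by move: dQ3_le1; rewrite exprS; lra.
  lra.
have lnlower : (- (ln 2 + 2 * ln Q) <= ln (eval_abs xi P))%R.
  have -> : (ln 2 + 2 * ln Q = ln (2 * Q ^+ 2))%R.
    by rewrite lnM ?posrE ?exprn_gt0 // lnXn // mulr_natl.
  rewrite -lnV ?posrE ?mulr_gt0 ?exprn_gt0 // ler_ln ?posrE //.
    by rewrite invr_gt0 mulr_gt0 ?exprn_gt0.
  exact: eval_abs_gt0.
apply: le_trans lnlower; rewrite lerN2 /X lnM ?posrE ?invr_gt0 // lnV ?posrE //.
have : ((s + 1) * ln 2 < ln Q * (s - 2))%R.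
  by rewrite -ltr_pdivrMr ?subr_gt0 // -ltr_expR (lnK Q_gt0).
lra.
Qed.

Lemma w_hat_any_ge : 2%:E <= w_hat any_polys 2 xi.
Proof.
have [C C_gt0 CP] := dirichlet xi 2.
apply: (w_hat_ge tr_xi (C := C) (N0 := 0)) => // N _ N_gt0.
by have [P [? ? ? ?]] := CP N N_gt0; exists P.
Qed.

(** A nonzero constant is too large to be the polynomial given by [dirichlet] in
    degree 1 once N > C, so that polynomial is linear, hence irreducible. *)
Lemma w_hat_ge1 K : (irr_polys `<=` K)%classic -> 1 <= w_hat K 2 xi.
Proof.
move=> irrK; have [C C_gt0 CP] := dirichlet xi 1.
apply: (w_hat_ge tr_xi (m := 1) (C := C) (N0 := (Num.truncn C).+1)) => // N N0N N_gt0.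
have [P [P_neq0 sP hP evP]] := CP N N_gt0; exists P; split=> //; last first.
  exact: leq_trans sP _.
apply: irrK; apply: irr_of_size2; apply/eqP.
rewrite eqn_leq sP ltnNge; apply/negP => /size1_polyC PE.
have c_neq0 : (P`_0 != 0)%R.
  by apply: contraNneq P_neq0 => c0; rewrite PE c0 polyC0.
have C_lt : (C < N%:R)%R.
  by rewrite (lt_le_trans (truncnS_gt _)) // ler_nat.
have : (1 <= C / N%:R)%R.
  have := evP; rewrite expr1; apply: le_trans.
  by rewrite PE /eval_abs map_polyC hornerC intr_ge1.
by rewrite ler_pdivlMr ?ltr0n // mul1r leNgt C_lt.
Qed.

Lemma w_hat_sep_le_w_sup K :
  (irr_polys `<=` K)%classic -> (K `<=` sep_polys)%classic ->
  3%:E < w_sup 1 xi -> w_hat K 2 xi <= 1 + 2%:E / (w_sup 1 xi - 1).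
Proof.
move=> irrK Ksep w_gt3; apply/lee_addgt0Pr => e e_gt0.
case W : (w_sup 1 xi) w_gt3 => [r| |] // w_gt3.
- rewrite lte_fin in w_gt3.
  have r1_gt0 : (0 < r - 1)%R by lra.
  rewrite -EFinB inver gt_eqF // -EFinM -!EFinD.
  set u := (2 / (r - 1))%R; have u_gt0 : (0 < u)%R by rewrite divr_gt0.
  have uE : (u * (r - 1) = 2)%R by rewrite divfK // gt_eqF.
  pose s := (1 + u + e)%R.
  have t_gt0 : (0 < u + e)%R by rewrite addr_gt0.
  (* With s = 1 + u + e, this is (s + 1)/(s - 1) < r, where equality would hold
     for e = 0. *)
  have lt_r : ((u + e + 2) / (u + e) < r)%R.
    rewrite ltr_pdivrMr //.
    have : (0 < e * (r - 1))%R by rewrite mulr_gt0.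
    lra.
  have [w w_lo w_hi] : exists2 w, ((u + e + 2) / (u + e) < w)%R & (w < r)%R.
    by exists (((u + e + 2) / (u + e) + r) / 2)%R; lra.
  apply: (@w_hat_sep_le K s w) => //; first by rewrite /s; lra.
    by move: w_lo; rewrite /s ltr_pdivrMr //; lra.
  by rewrite W lte_fin.
- rewrite addye // invey mule0 adde0 -EFinD.
  (* Any w > (s + 1)/(s - 1) = 1 + 2/e works for s = 1 + e. *)
  apply: (@w_hat_sep_le K (1 + e)%R (3 + 2 / e)%R) => //; first by lra.
    have : (2 / e * e = 2)%R by rewrite divfK // gt_eqF.
    lra.
  by rewrite W ltry.
Qed.

End UniformExponents.

Unset Implicit Arguments.
Set Strict Implicit.

Theorem theorem3p5 (R : realType) :
  (forall xi : R, transcendental xi -> 3%:E < w_sup 1 xi ->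
     [/\ w_hat sep_polys 2 xi <= 1 + 2%:E / (w_sup 1 xi - 1),
         1 + 2%:E / (w_sup 1 xi - 1) < 2%:E
       & w_hat any_polys 2 xi = 2%:E]) /\
  (forall xi : R, liouville xi ->
     w_hat irr_polys 2 xi = 1 /\ w_hat sep_polys 2 xi = 1).
Proof.
split=> [xi tr_xi w_gt3|xi [tr_xi w_oo]].
  split.
  - by apply: w_hat_sep_le_w_sup => //; exact: irr_sub_sep.
  - case: (w_sup 1 xi) w_gt3 => [r| |] //.
      rewrite lte_fin => r_gt3.
      rewrite -EFinB inver gt_eqF; last by lra.
      rewrite -EFinM -EFinD lte_fin.
      have : (2 / (r - 1) < 1)%R by rewrite ltr_pdivrMr; lra.
      lra.
    by move=> _; rewrite addye // invey mule0 adde0 lte_fin; lra.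
  - apply/eqP; rewrite eq_le (w_hat_any_ge tr_xi) andbT.
    apply/lee_addgt0Pr => e e_gt0; rewrite -EFinD.
    by apply: w_hat_any_le => //; lra.
have w_gt3 : 3%:E < w_sup 1 xi by rewrite w_oo ltry.
have eq1 K : (irr_polys `<=` K)%classic -> (K `<=` sep_polys)%classic ->
    w_hat K 2 xi = 1.
  move=> irrK Ksep; apply/eqP; rewrite eq_le (w_hat_ge1 tr_xi irrK) andbT.
  have := w_hat_sep_le_w_sup tr_xi irrK Ksep w_gt3.
  by rewrite w_oo addye // invey mule0 adde0.
by split; apply: eq1 => //; exact: irr_sub_sep.
Qed.
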